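(* Let $N\in\mathbb N$, $N\ge 3$, and $q=e^{i\gamma}$, where $\frac{\pi}{N+1}<\gamma<\frac{\pi}{N}$. Suppose, in addition, that $$[N+2]+2[N]<0 .$$ Let $n\ge 1$ and let $T\in\mathrm{Mat}(n^2,\mathbb C)$ be a Hermitian matrix, $T\ne 0$, satisfying $$T^2=(q+q^{-1})\,T,\qquad (T\otimes I)(I\otimes T)(T\otimes I)-(I\otimes T)(T\otimes I)(I\otimes T)=T\otimes I-I\otimes T,$$ where $I\in\mathrm{Mat}(n,\mathbb C)$ is the identity matrix and $\otimes$ is the Kronecker product. Let $\tau: H_N(q)\to\mathrm{Mat}(n^N,\mathbb C)$ be the corresponding representation, $\tau(\mathsf T_k)=I^{\otimes(k-1)}\otimes T\otimes I^{\otimes(N-k-1)}$ for $k=1,\ldots,N-1$. Then $\tau(\mathsf P_{N-1})=0$.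
   Context: Here $q\in\mathbb C$ is a fixed number with $|q|=1$, and $H_N(q)$ is the unital associative complex algebra with generators $\mathsf R_1,\ldots,\mathsf R_{N-1}$ and relations $\mathsf R_k^2 = \mathsf 1 + (q-q^{-1})\mathsf R_k$; $\mathsf R_k \mathsf R_m \mathsf R_k = \mathsf R_m \mathsf R_k \mathsf R_m$ for $|k-m|=1$; $\mathsf R_k \mathsf R_m = \mathsf R_m \mathsf R_k$ for $|k-m|\ge 2$. With $\mathsf T_k=q^{-1}\cdot\mathsf 1+\mathsf R_k$ these relations are equivalent to $\mathsf T_k^2=(q+q^{-1})\mathsf T_k$; $\mathsf T_k\mathsf T_m\mathsf T_k-\mathsf T_m\mathsf T_k\mathsf T_m=\mathsf T_k-\mathsf T_m$ for $|k-m|=1$; $\mathsf T_k\mathsf T_m=\mathsf T_m\mathsf T_k$ for $|k-m|\ge2$. For $k\in\mathbb Z$, $[k] = \frac{q^k-q^{-k}}{q-q^{-1}}=\frac{\sin(k\gamma)}{\sin\gamma}$. The $q$-antisymmetrizers $\mathsf P_1,\ldots,\mathsf P_N\in H_N(q)$ are defined recursively by $\mathsf P_1=\mathsf 1$ and $\mathsf P_{k+1}=\mathsf P_k-\frac{[k]}{[k+1]}\,\mathsf P_k\mathsf T_k\mathsf P_k$ for $k=1,\ldots,N-1$ (the denominators $[2],\ldots,[N]$ are nonzero for the given range of $\gamma$). *)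

(* Defs.v *)
From HB Require Import structures.
From mathcomp Require Import all_boot all_order all_algebra.
From mathcomp Require Import all_classical all_reals all_analysis.
From mathcomp Require Import complex mxtens.

Set Implicit Arguments.
Unset Strict Implicit.
Unset Printing Implicit Defensive.

Import Order.TTheory GRing.Theory Num.Theory.
Local Open Scope ring_scope.
Local Open Scope quotient_scope.

(* The labels 1, ..., N - 1 of the generators; [val] gives the label. *)
Definition hecke_gen (N : nat) := {k : nat | (0 < k < N)%N}.

Section HeckePresentation.
Variables (F : fieldType) (N : nat) (q : F).

(* Formal noncommutative polynomial expressions in the R_k. *)
Inductive hterm : Type :=
| HGen of hecke_gen N
| HZero
| HOne
| HOpp of hterm
| HAdd of hterm & hterm
| HMul of hterm & hterm
| HScale of F & hterm.

HB.instance Definition _ := gen_eqMixin hterm.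
HB.instance Definition _ := gen_choiceMixin hterm.

(* The least congruence that contains the axioms of unital associative
   F-algebras and the three families of relations of the Hecke algebra. *)
Inductive hcong : hterm -> hterm -> Prop :=
| hcong_refl x : hcong x x
| hcong_sym x y : hcong x y -> hcong y x
| hcong_trans y x z : hcong x y -> hcong y z -> hcong x z
| hcong_opp x x' : hcong x x' -> hcong (HOpp x) (HOpp x')
| hcong_add x x' y y' :
    hcong x x' -> hcong y y' -> hcong (HAdd x y) (HAdd x' y')
| hcong_mul x x' y y' :
    hcong x x' -> hcong y y' -> hcong (HMul x y) (HMul x' y')
| hcong_scale a x x' : hcong x x' -> hcong (HScale a x) (HScale a x')
| hcong_addA x y z : hcong (HAdd x (HAdd y z)) (HAdd (HAdd x y) z)
| hcong_addC x y : hcong (HAdd x y) (HAdd y x)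
| hcong_add0 x : hcong (HAdd HZero x) x
| hcong_addN x : hcong (HAdd (HOpp x) x) HZero
| hcong_mulA x y z : hcong (HMul x (HMul y z)) (HMul (HMul x y) z)
| hcong_1mul x : hcong (HMul HOne x) x
| hcong_mul1 x : hcong (HMul x HOne) x
| hcong_mulDl x y z :
    hcong (HMul (HAdd x y) z) (HAdd (HMul x z) (HMul y z))
| hcong_mulDr x y z :
    hcong (HMul x (HAdd y z)) (HAdd (HMul x y) (HMul x z))
| hcong_scaleA a b x : hcong (HScale a (HScale b x)) (HScale (a * b) x)
| hcong_scale1 x : hcong (HScale 1 x) x
| hcong_scaleDr a x y :
    hcong (HScale a (HAdd x y)) (HAdd (HScale a x) (HScale a y))
| hcong_scaleDl x a b :
    hcong (HScale (a + b) x) (HAdd (HScale a x) (HScale b x))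
| hcong_scaleAl a x y :
    hcong (HScale a (HMul x y)) (HMul (HScale a x) y)
| hcong_scaleAr a x y :
    hcong (HScale a (HMul x y)) (HMul x (HScale a y))
| hcong_quad k :
    hcong (HMul (HGen k) (HGen k)) (HAdd HOne (HScale (q - q^-1) (HGen k)))
| hcong_braid k m : `|(val k)%:Z - (val m)%:Z| = 1 ->
    hcong (HMul (HMul (HGen k) (HGen m)) (HGen k))
          (HMul (HMul (HGen m) (HGen k)) (HGen m))
| hcong_comm k m : `|(val k)%:Z - (val m)%:Z| >= 2 ->
    hcong (HMul (HGen k) (HGen m)) (HMul (HGen m) (HGen k)).

Definition hcongb : rel hterm := fun x y => `[< hcong x y >].

Lemma hcongb_refl : reflexive hcongb.
Proof. by move=> x; apply/asboolP; exact: hcong_refl. Qed.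

Lemma hcongb_sym : symmetric hcongb.
Proof. by move=> x y; apply/asboolP/asboolP; exact: hcong_sym. Qed.

Lemma hcongb_trans : transitive hcongb.
Proof.
move=> y x z /asboolP xy /asboolP yz; apply/asboolP; exact: hcong_trans xy yz.
Qed.

Canonical hcong_equiv := EquivRel hcongb hcongb_refl hcongb_sym hcongb_trans.

Definition hecke : Type := {eq_quot hcong_equiv}.
HB.instance Definition _ := Choice.on hecke.

Let pi (x : hterm) : hecke := \pi_{eq_quot hcong_equiv} x.
Let rp (x : hecke) : hterm := repr (x : {eq_quot hcong_equiv}).

Local Lemma piP x y : hcong x y <-> pi x = pi y.
Proof.
split=> [xy|/eqmodP/asboolP//]; apply/eqmodP; exact/asboolP.
Qed.

Local Lemma rpK x : pi (rp x) = x.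
Proof. exact: reprK. Qed.

Local Lemma rp_pi x : hcong (rp (pi x)) x.
Proof. by apply/piP; rewrite rpK. Qed.

Definition hecke_opp (x : hecke) : hecke := pi (HOpp (rp x)).
Definition hecke_add (x y : hecke) : hecke := pi (HAdd (rp x) (rp y)).
Definition hecke_mul (x y : hecke) : hecke := pi (HMul (rp x) (rp y)).
Definition hecke_scale (a : F) (x : hecke) : hecke := pi (HScale a (rp x)).

Local Lemma piN x : hecke_opp (pi x) = pi (HOpp x).
Proof. by apply/piP; apply: hcong_opp; exact: rp_pi. Qed.

Local Lemma piD x y : hecke_add (pi x) (pi y) = pi (HAdd x y).
Proof. by apply/piP; apply: hcong_add; exact: rp_pi. Qed.

Local Lemma piM x y : hecke_mul (pi x) (pi y) = pi (HMul x y).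
Proof. by apply/piP; apply: hcong_mul; exact: rp_pi. Qed.

Local Lemma piZ a x : hecke_scale a (pi x) = pi (HScale a x).
Proof. by apply/piP; apply: hcong_scale; exact: rp_pi. Qed.

Let piE := (piN, piD, piM, piZ).

Local Lemma hecke_addA : associative hecke_add.
Proof.
move=> x y z; rewrite -[x]rpK -[y]rpK -[z]rpK !piE.
by apply/piP; exact: hcong_addA.
Qed.

Local Lemma hecke_addC : commutative hecke_add.
Proof.
by move=> x y; rewrite -[x]rpK -[y]rpK !piE; apply/piP; exact: hcong_addC.
Qed.

Local Lemma hecke_add0 : left_id (pi HZero) hecke_add.
Proof. by move=> x; rewrite -[x]rpK !piE; apply/piP; exact: hcong_add0. Qed.

Local Lemma hecke_addN : left_inverse (pi HZero) hecke_opp hecke_add.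
Proof. by move=> x; rewrite -[x]rpK !piE; apply/piP; exact: hcong_addN. Qed.

HB.instance Definition _ :=
  GRing.isZmodule.Build hecke hecke_addA hecke_addC hecke_add0 hecke_addN.

Local Lemma hecke_mulA : associative hecke_mul.
Proof.
move=> x y z; rewrite -[x]rpK -[y]rpK -[z]rpK !piE.
by apply/piP; exact: hcong_mulA.
Qed.

Local Lemma hecke_1mul : left_id (pi HOne) hecke_mul.
Proof. by move=> x; rewrite -[x]rpK !piE; apply/piP; exact: hcong_1mul. Qed.

Local Lemma hecke_mul1 : right_id (pi HOne) hecke_mul.
Proof. by move=> x; rewrite -[x]rpK !piE; apply/piP; exact: hcong_mul1. Qed.

Local Lemma hecke_mulDl : left_distributive hecke_mul hecke_add.
Proof.
move=> x y z; rewrite -[x]rpK -[y]rpK -[z]rpK !piE.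
by apply/piP; exact: hcong_mulDl.
Qed.

Local Lemma hecke_mulDr : right_distributive hecke_mul hecke_add.
Proof.
move=> x y z; rewrite -[x]rpK -[y]rpK -[z]rpK !piE.
by apply/piP; exact: hcong_mulDr.
Qed.

Section Lift.
Variables (A : algType F) (r : hecke_gen N -> A).

Fixpoint hterm_eval (x : hterm) : A :=
  match x with
  | HGen k => r k
  | HZero => 0
  | HOne => 1
  | HOpp y => - hterm_eval y
  | HAdd y z => hterm_eval y + hterm_eval z
  | HMul y z => hterm_eval y * hterm_eval z
  | HScale a y => a *: hterm_eval y
  end.

Hypothesis r_quad : forall k, r k * r k = 1 + (q - q^-1) *: r k.
Hypothesis r_braid : forall k m, `|(val k)%:Z - (val m)%:Z| = 1 ->
  r k * r m * r k = r m * r k * r m.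
Hypothesis r_comm : forall k m, `|(val k)%:Z - (val m)%:Z| >= 2 ->
  r k * r m = r m * r k.

Lemma hterm_eval_cong x y : hcong x y -> hterm_eval x = hterm_eval y.
Proof.
elim=> {x y} //=.
- by move=> y x z _ -> _ ->.
- by move=> x x' _ ->.
- by move=> x x' y y' _ -> _ ->.
- by move=> x x' y y' _ -> _ ->.
- by move=> a x x' _ ->.
- by move=> x y z; rewrite addrA.
- by move=> x y; rewrite addrC.
- by move=> x; rewrite add0r.
- by move=> x; rewrite addNr.
- by move=> x y z; rewrite mulrA.
- by move=> x; rewrite mul1r.
- by move=> x; rewrite mulr1.
- by move=> x y z; rewrite mulrDl.
- by move=> x y z; rewrite mulrDr.
- by move=> a b x; rewrite scalerA.
- by move=> x; rewrite scale1r.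
- by move=> a x y; rewrite scalerDr.
- by move=> x a b; rewrite scalerDl.
- by move=> a x y; rewrite scalerAl.
- by move=> a x y; rewrite scalerAr.
Qed.

End Lift.

(* H_N(q) is not the zero ring: R_k |-> q is a one-dimensional
   representation (R_k |-> 1 in the degenerate case q = 0). *)
Local Lemma hecke_1neq0 : pi HOne != pi HZero.
Proof.
apply/eqP => /piP H.
pose c : F^o := if q == 0 then 1 else q.
have cc : c * c = 1 + (q - q^-1) *: c.
  rewrite /c /GRing.scale /=; have [->|q0] := eqVneq q 0.
    by rewrite invr0 subrr mul0r addr0 mulr1.
  by rewrite mulrBl mulVf // addrCA subrr addr0.
have := @hterm_eval_cong F^o (fun=> c) (fun=> cc) (fun _ _ _ => erefl)
  (fun _ _ _ => erefl) _ _ H.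
by move/eqP; rewrite /= oner_eq0.
Qed.

HB.instance Definition _ := GRing.Zmodule_isNzRing.Build hecke
  hecke_mulA hecke_1mul hecke_mul1 hecke_mulDl hecke_mulDr hecke_1neq0.

Local Lemma hecke_scaleA a b v :
  hecke_scale a (hecke_scale b v) = hecke_scale (a * b) v.
Proof. by rewrite -[v]rpK !piE; apply/piP; exact: hcong_scaleA. Qed.

Local Lemma hecke_scale1 : left_id 1 hecke_scale.
Proof. by move=> v; rewrite -[v]rpK !piE; apply/piP; exact: hcong_scale1. Qed.

Local Lemma hecke_scaleDr : right_distributive hecke_scale hecke_add.
Proof.
move=> a x y; rewrite -[x]rpK -[y]rpK !piE; apply/piP; exact: hcong_scaleDr.
Qed.

Local Lemma hecke_scaleDl v a b :
  hecke_scale (a + b) v = hecke_add (hecke_scale a v) (hecke_scale b v).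
Proof. by rewrite -[v]rpK !piE; apply/piP; exact: hcong_scaleDl. Qed.

HB.instance Definition _ := GRing.Zmodule_isLmodule.Build F hecke
  hecke_scaleA hecke_scale1 hecke_scaleDr hecke_scaleDl.

Local Lemma hecke_scaleAl (a : F) (x y : hecke) :
  a *: (x * y) = (a *: x) * y.
Proof.
change (hecke_scale a (hecke_mul x y) = hecke_mul (hecke_scale a x) y).
by rewrite -[x]rpK -[y]rpK !piE; apply/piP; exact: hcong_scaleAl.
Qed.

HB.instance Definition _ := GRing.Lmodule_isLalgebra.Build F hecke
  hecke_scaleAl.

Local Lemma hecke_scaleAr (a : F) (x y : hecke) :
  a *: (x * y) = x * (a *: y).
Proof.
change (hecke_scale a (hecke_mul x y) = hecke_mul x (hecke_scale a y)).
by rewrite -[x]rpK -[y]rpK !piE; apply/piP; exact: hcong_scaleAr.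
Qed.

HB.instance Definition _ := GRing.Lalgebra_isAlgebra.Build F hecke
  hecke_scaleAr.

Definition heckeR (k : hecke_gen N) : hecke := pi (HGen k).

Lemma heckeR_quad k : heckeR k * heckeR k = 1 + (q - q^-1) *: heckeR k.
Proof.
change (hecke_mul (heckeR k) (heckeR k) =
        hecke_add (pi HOne) (hecke_scale (q - q^-1) (heckeR k))).
by rewrite /heckeR !piE; apply/piP; exact: hcong_quad.
Qed.

Lemma heckeR_braid k m : `|(val k)%:Z - (val m)%:Z| = 1 ->
  heckeR k * heckeR m * heckeR k = heckeR m * heckeR k * heckeR m.
Proof.
move=> km; change (hecke_mul (hecke_mul (heckeR k) (heckeR m)) (heckeR k) =
                   hecke_mul (hecke_mul (heckeR m) (heckeR k)) (heckeR m)).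
by rewrite /heckeR !piE; apply/piP; exact: hcong_braid.
Qed.

Lemma heckeR_comm k m : `|(val k)%:Z - (val m)%:Z| >= 2 ->
  heckeR k * heckeR m = heckeR m * heckeR k.
Proof.
move=> km; change (hecke_mul (heckeR k) (heckeR m) =
                   hecke_mul (heckeR m) (heckeR k)).
by rewrite /heckeR !piE; apply/piP; exact: hcong_comm.
Qed.

Lemma hecke_universal (A : algType F) (r : hecke_gen N -> A) :
  (forall k, r k * r k = 1 + (q - q^-1) *: r k) ->
  (forall k m, `|(val k)%:Z - (val m)%:Z| = 1 ->
     r k * r m * r k = r m * r k * r m) ->
  (forall k m, `|(val k)%:Z - (val m)%:Z| >= 2 -> r k * r m = r m * r k) ->
  exists! f : hecke -> A,
    [/\ linear f, monoid_morphism f & forall k, f (heckeR k) = r k].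
Proof.
move=> rq rb rc; pose f (x : hecke) := hterm_eval r (rp x).
have fpi x : f (pi x) = hterm_eval r x.
  by apply: hterm_eval_cong => //; exact: rp_pi.
exists f; split.
  split=> [a x y|//|k]; last exact: fpi.
    change (f (hecke_add (hecke_scale a x) y) = a *: f x + f y).
    by rewrite -[x]rpK -[y]rpK !piE !fpi.
  split=> [|x y]; first exact: fpi.
  change (f (hecke_mul x y) = f x * f y).
  by rewrite -[x]rpK -[y]rpK !piE !fpi.
move=> g [glin [g1 gM] gR]; apply: funext => x; rewrite -[x]rpK fpi.
have g0 : g 0 = 0.
  by have := glin (-1) 0 0; rewrite scaler0 addr0 scaleN1r addNr.
have gD y z : g (y + z) = g y + g z.
  by rewrite -[y in LHS]scale1r glin scale1r.
have gZ a y : g (a *: y) = a *: g y.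
  by rewrite -[_ *: y]addr0 glin g0 addr0.
elim: (rp x) => /= [k|||t IH|t IH u IH'|t IH u IH'|a t IH].
- by rewrite -gR.
- by rewrite -g0.
- by rewrite -g1.
- rewrite -piN IH; apply/esym/eqP; rewrite -addr_eq0 -gD.
  by rewrite addNr g0.
- by rewrite -piD IH IH' -gD.
- by rewrite -piM IH IH' -gM.
- by rewrite -piZ IH -gZ.
Qed.

Definition heckeT (k : hecke_gen N) : hecke := q^-1 *: 1 + heckeR k.

Definition qnum (k : int) : F := (q ^ k - q ^ (- k)) / (q - q^-1).

(* P_k for 1 <= k <= N; the values at k = 0 and k > N are irrelevant. *)
Fixpoint qantisym (k : nat) : hecke :=
  match k with
  | k'.+1 =>
    match insub k' : option (hecke_gen N) with
    | Some g => qantisym k' -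
        (qnum k' / qnum k'.+1) *: (qantisym k' * heckeT g * qantisym k')
    | None => 1
    end
  | 0 => 1
  end.

Lemma qantisym1 : qantisym 1 = 1.
Proof. by rewrite /= insubN. Qed.

Lemma qantisymS (g : hecke_gen N) (k := val g) :
  qantisym k.+1 = qantisym k -
    (qnum k / qnum k.+1) *: (qantisym k * heckeT g * qantisym k).
Proof. by rewrite /= valK. Qed.

End HeckePresentation.

(* e^{i gamma} *)
Definition expi (R : realType) (gamma : R) : R[i] :=
  (cos gamma +i* sin gamma)%C.

Section Sites.
Variables (C : pzRingType) (n : nat).

(* T (x) I and I (x) T, with the sizes n^2 * n and n * n^2 both rewritten
   as n^3. *)
Definition tensTI (T : 'M[C]_(n ^ 2)) : 'M[C]_(n ^ 3) :=
  castmx (esym (expnSr n 2), esym (expnSr n 2)) (T *t (1%:M : 'M[C]_n)).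

Definition tensIT (T : 'M[C]_(n ^ 2)) : 'M[C]_(n ^ 3) :=
  castmx (esym (expnS n 2), esym (expnS n 2)) ((1%:M : 'M[C]_n) *t T).

Lemma site_size (N : nat) (k : hecke_gen N) :
  (n ^ (val k - 1) * n ^ 2 * n ^ (N - val k - 1) = n ^ N)%N.
Proof.
case: k => -[//|k] /= kN; rewrite -!expnD; congr (n ^ _)%N.
by rewrite -subnDA addn1 subn1 addn2 subnKC.
Qed.

Definition site_mx (N : nat) (T : 'M[C]_(n ^ 2)) (k : hecke_gen N) :
    'M[C]_(n ^ N) :=
  castmx (site_size k, site_size k)
    ((1%:M : 'M[C]_n) ^t (val k - 1) *t T *t
     (1%:M : 'M[C]_n) ^t (N - val k - 1)).

End Sites.

(* Main.v *)
Require Import Defs.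
From mathcomp Require Import all_boot all_order all_algebra.
From mathcomp Require Import all_classical all_reals all_analysis.
From mathcomp Require Import complex mxtens.
From mathcomp Require Import ring zify.
Set Implicit Arguments.
Unset Strict Implicit.
Unset Printing Implicit Defensive.
Import Order.TTheory GRing.Theory Num.Theory.
Local Open Scope ring_scope.

(* Since T is Hermitian and [2] > 0, the T_k are positive multiples of
   orthogonal projections, and the antisymmetrizers P_1, ..., P_N are Hermitian
   idempotents.  On N + 2 tensor factors (one is free to add factors on the
   right), the identity P_N T_N P_N T_N P_N = ([N+1]/[N]) P_N T_N P_N with
   [N+1] < 0 < [N] forces P_N T_N = 0.  Multiplying the braid relation of T_N
   and T_{N+1} by P_N then gives P_N T_{N+1} = 0; as P_N and T_{N+1} act on
   disjoint factors and T <> 0, this means P_N = 0.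

   Let A = P_{N-1}, X = T_N, Y = T_{N-1}.  Now P_N = 0 reads
   A Y A = ([N]/[N-1]) A, and with the braid relation
   A X (Y X Y) X A = [2] ([N+2] + 2[N])/[N-1] A X.  The left-hand side is a
   positive and the right-hand side a negative semidefinite matrix, so A X = 0,
   and again A = 0 because A and X act on disjoint factors. *)

(** * Recurrence and initial value of the q-numbers *)

Lemma qnumSS (F : fieldType) (q : F) (k : nat) : q != 0 ->
  qnum q k.+2 = (q + q^-1) * qnum q k.+1 - qnum q k.
Proof.
move=> q0; rewrite /qnum mulrA -mulrBl; congr (_ / _).
rewrite -!exprnN -!exprnP !exprS; field.
by rewrite expf_neq0.
Qed.

Lemma qnum1 (F : fieldType) (q : F) : q != q^-1 -> qnum q 1%N = 1.
Proof.
by move=> qq; rewrite /qnum -exprnN -exprnP expr1 divff // subr_eq0.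
Qed.

(** * Antisymmetrizers of matrices satisfying the Hecke relations *)

Section Antisymmetrizers.
Variables (F : fieldType) (q : F) (d : nat) (t : nat -> 'M[F]_d).

(** The index is not tied to N, so that the recursion can also be run on N + 2 tensor factors; the
    value at 0 is a dummy. *)
Fixpoint antisym (k : nat) : 'M[F]_d :=
  match k with
  | (k'.+1 as k1).+1 => antisym k1 -
      (qnum q k1 / qnum q k1.+1) *: (antisym k1 *m t k1 *m antisym k1)
  | _ => 1%:M
  end.

Lemma antisymS k : antisym k.+2 = antisym k.+1 -
  (qnum q k.+1 / qnum q k.+2) *: (antisym k.+1 *m t k.+1 *m antisym k.+1).
Proof. by []. Qed.

Variables (M : nat).
Hypotheses (q0 : q != 0) (q1 : q != q^-1).
Hypothesis t_quad : forall k, (0 < k < M)%N -> t k *m t k = (q + q^-1) *: t k.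
Hypothesis t_braid : forall k, (0 < k)%N -> (k.+1 < M)%N ->
  t k *m t k.+1 *m t k - t k.+1 *m t k *m t k.+1 = t k - t k.+1.
Hypothesis t_comm : forall k m, (0 < k)%N -> (k.+1 < m)%N -> (m < M)%N ->
  t k *m t m = t m *m t k.

(** Only [t 1], ..., [t k.-1] occur in [antisym k], and their indices differ from [m] by at least
    2. *)
Lemma antisym_comm k m : (k < m)%N -> (m < M)%N ->
  antisym k *m t m = t m *m antisym k.
Proof.
elim: k => [|[|k] IHk] km mM; rewrite ?mul1mx ?mulmx1 //.
have {}IHk := IHk (ltnW km) mM.
rewrite antisymS mulmxBl mulmxBr -scalemxAl -scalemxAr IHk.
congr (_ - _ *: _).
rewrite -[LHS]mulmxA IHk mulmxA -[_ *m t m]mulmxA t_comm // !mulmxA.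
by rewrite IHk.
Qed.

(** Both claims go through one induction: the second at [k] yields [antisym k.+1 *m t k = 0], which
    gives idempotency at [k.+1] and, with the braid relation, the second claim there. *)
Lemma antisym_idem_quad k : (0 < k < M)%N ->
  (forall j, (0 < j <= k)%N -> qnum q j != 0) ->
  antisym k *m antisym k = antisym k /\
  antisym k *m t k *m antisym k *m t k =
    (qnum q k.+1 / qnum q k) *: (antisym k *m t k).
Proof.
case: k => // k kM; elim: k kM => [|k IHk] kM hk.
  rewrite /= !mulmx1 !mul1mx; split=> //.
  by rewrite t_quad // (qnumSS _ q0) qnum1 // /qnum subrr mul0r divr1 mulr1 subr0.
have [||idem quad] := IHk; first by case/andP: kM => _ /ltnW.
  by move=> j /andP[j0 jk]; apply: hk; rewrite j0 ltnW.
set p := antisym k.+1 in idem quad *; set p' := antisym k.+2.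
have p'E : p' = p - (qnum q k.+1 / qnum q k.+2) *: (p *m t k.+1 *m p) by [].
have k1 : qnum q k.+1 != 0 by apply: hk => /=.
have k2 : qnum q k.+2 != 0 by apply: hk; rewrite /=.
have p'p : p' *m p = p' 
  by rewrite p'E mulmxBl -scalemxAl -[_ *m p *m p]mulmxA idem.
(* The coefficient in the recursion is the inverse of the one in [quad]. *)
have p't : p' *m t k.+1 = 0.
  rewrite p'E mulmxBl -scalemxAl quad scalerA.
  have -> : qnum q k.+1 / qnum q k.+2 * (qnum q k.+2 / qnum q k.+1) = 1.
    by rewrite mulrA divfK // divff.
  by rewrite scale1r subrr.
have idem' : p' *m p' = p'.
  by rewrite {2}p'E mulmxBr -scalemxAr !mulmxA p'p p't mul0mx scaler0 subr0.
split=> //; rewrite {2}p'E mulmxBr mulmxBl -scalemxAr -scalemxAl.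
have pc : p *m t k.+2 = t k.+2 *m p.
  by apply: antisym_comm => //; case/andP: kM.
have -> : p' *m t k.+2 *m p *m t k.+2 = (q + q^-1) *: (p' *m t k.+2).
  by rewrite -[p' *m _ *m p]mulmxA -pc mulmxA p'p -mulmxA t_quad // scalemxAr.
(* The left [p] commutes to [p'] and is absorbed. The right one moves to the far end; as [p'] kills
   [t k.+1], the braid relation reduces the triple product under [p'] to [t k.+2], and then this [p]
   is absorbed too. *)
have -> : p' *m t k.+2 *m (p *m t k.+1 *m p) *m t k.+2 = p' *m t k.+2.
  rewrite !mulmxA -[p' *m _ *m p]mulmxA -pc mulmxA p'p.
  rewrite -[_ *m p *m t k.+2]mulmxA pc !mulmxA.
  have := t_braid (ltn0Sn k) (proj2 (andP kM)).
  move/eqP; rewrite subr_eq addrC -subr_eq => /eqP B.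
  have : p' *m (t k.+2 *m t k.+1 *m t k.+2) *m p = p' *m t k.+2 *m p.
    by rewrite -B mulmxBr mulmxBr !mulmxA p't !mul0mx !sub0r opprK.
  rewrite !mulmxA => ->.
  by rewrite -mulmxA -pc mulmxA p'p.
(* What remains is [2] - [k+1]/[k+2] = [k+3]/[k+2]. *)
rewrite -scalerBl; congr (_ *: _).
by rewrite (qnumSS k.+1 q0) mulrBl mulfK.
Qed.

End Antisymmetrizers.

(** * Adjoint matrices and the trace norm *)

Section Adjoint.
Variable C : numClosedFieldType.

Definition adjmx m n (x : 'M[C]_(m, n)) : 'M[C]_(n, m) := map_mx Num.conj x^T.

Lemma adjmxM m n p (x : 'M[C]_(m, n)) (y : 'M[C]_(n, p)) :
  adjmx (x *m y) = adjmx y *m adjmx x.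
Proof. by rewrite /adjmx trmx_mul map_mxM. Qed.

Lemma adjmxB m n (x y : 'M[C]_(m, n)) : adjmx (x - y) = adjmx x - adjmx y.
Proof. by rewrite /adjmx raddfB map_mxB. Qed.

Lemma adjmxZ m n a (x : 'M[C]_(m, n)) : adjmx (a *: x) = a^* *: adjmx x.
Proof. by apply/matrixP => i j; rewrite !mxE rmorphM. Qed.

Lemma mxtrace_mul_adj m n (x : 'M[C]_(m, n)) :
  \tr (x *m adjmx x) = \sum_i \sum_j `|x i j| ^+ 2.
Proof.
apply: eq_bigr => i _; rewrite mxE; apply: eq_bigr => j _.
by rewrite !mxE normCK.
Qed.

Lemma mxtrace_mul_adj_ge0 m n (x : 'M[C]_(m, n)) : 0 <= \tr (x *m adjmx x).
Proof.
rewrite mxtrace_mul_adj; apply: sumr_ge0 => i _; apply: sumr_ge0 => j _.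
by rewrite exprn_ge0.
Qed.

Lemma mxtrace_mul_adj_eq0 m n (x : 'M[C]_(m, n)) :
  \tr (x *m adjmx x) = 0 -> x = 0.
Proof.
rewrite mxtrace_mul_adj => /eqP; rewrite psumr_eq0 => [|i _]; last first.
  by apply: sumr_ge0 => j _; rewrite exprn_ge0.
move=> /allP x0; apply/matrixP => i j; rewrite mxE.
have /implyP /(_ isT) := x0 i (mem_index_enum i).
rewrite psumr_eq0 => [/allP/(_ j (mem_index_enum j))/implyP/(_ isT)|j' _].
  by rewrite expf_eq0 normr_eq0 => /eqP.
by rewrite exprn_ge0.
Qed.

(** Both Gram matrices have nonnegative trace, so a negative factor between them forces the trace of
    [x *m adjmx x] to vanish. *)
Lemma gram_neg_eq0 m n p (x : 'M[C]_(m, n)) (y : 'M[C]_(m, p)) (c : C) :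
  c < 0 -> y *m adjmx y = c *: (x *m adjmx x) -> x = 0.
Proof.
move=> c0 /(congr1 mxtrace); rewrite mxtraceZ => yx.
apply: mxtrace_mul_adj_eq0; apply/le_anti/andP; split.
  by rewrite -(nmulr_rge0 _ c0) -yx mxtrace_mul_adj_ge0.
exact: mxtrace_mul_adj_ge0.
Qed.

End Adjoint.

(** * Vanishing forced by the signs of q-numbers *)

Section Positivity.
Variables (C : numClosedFieldType) (q : C) (d : nat) (t : nat -> 'M[C]_d).
Variables (M : nat).
Hypotheses (q0 : q != 0) (q1 : q != q^-1).
Hypothesis t_quad : forall k, (0 < k < M)%N -> t k *m t k = (q + q^-1) *: t k.
Hypothesis t_braid : forall k, (0 < k)%N -> (k.+1 < M)%N ->
  t k *m t k.+1 *m t k - t k.+1 *m t k *m t k.+1 = t k - t k.+1.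
Hypothesis t_comm : forall k m, (0 < k)%N -> (k.+1 < m)%N -> (m < M)%N ->
  t k *m t m = t m *m t k.
Hypothesis t_adj : forall k, (0 < k < M)%N -> adjmx (t k) = t k.
Hypothesis qnum_conj : forall k : nat, (qnum q k)^* = qnum q k.
Hypothesis q2 : 0 < q + q^-1.

Local Notation p := (antisym q t).

(** The recursion is palindromic, and its coefficients are real by [qnum_conj]. *)
Lemma antisym_adj k : (k <= M)%N -> adjmx (p k) = p k.
Proof.
have adj1 : adjmx 1%:M = 1%:M :> 'M[C]_d by rewrite /adjmx trmx1 map_mx1.
elim: k => [|[|k] IHk] kM //; have {}IHk := IHk (ltnW kM).
have conj_ratio i j : (qnum q (i : nat) / qnum q (j : nat))^* =
    qnum q i / qnum q j by rewrite rmorphM fmorphV; congr (_ * _^-1); apply: qnum_conj.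
by rewrite antisymS adjmxB adjmxZ conj_ratio !adjmxM IHk t_adj // mulmxA.
Qed.

Lemma antisym_mul_next k : (0 < k < M)%N ->
  (forall j, (0 < j <= k)%N -> 0 < qnum q j) -> qnum q k.+1 < 0 ->
  p k *m t k = 0.
Proof.
move=> kM qpos qneg.
have [|idem quad] := antisym_idem_quad q0 q1 t_quad t_braid t_comm kM.
  by move=> j /qpos/gt_eqF ->.
(* For [y = p k *m t k *m p k] and [x = p k *m t k] the Gram matrices are [k+1]/[k] y and [2] y;
   this is their ratio. *)
have c0 : qnum q k.+1 / qnum q k / (q + q^-1) < 0.
  rewrite pmulr_llt0 ?invr_gt0 // pmulr_llt0 // invr_gt0.
  by apply: qpos; rewrite leqnn andbT; case/andP: kM.
apply: (gram_neg_eq0 (y := p k *m t k *m p k) c0).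
have pA : adjmx (p k) = p k by apply: antisym_adj; case/andP: kM => _ /ltnW.
rewrite !adjmxM pA t_adj // !mulmxA -[_ *m p k *m p k]mulmxA idem quad.
rewrite -[p k *m t k *m t k]mulmxA t_quad // -scalemxAr -!scalemxAl scalerA.
by rewrite divfK // gt_eqF.
Qed.

(** In the braid relation multiplied by [p k], even the term starting with [t k.+1] dies: [p k]
    commutes past it and meets [t k]. *)
Lemma antisym_mul_next2 k : (0 < k)%N -> (k.+1 < M)%N ->
  p k *m t k = 0 -> p k *m t k.+1 = 0.
Proof.
move=> k0 kM pt; have pc : p k *m t k.+1 = t k.+1 *m p k.
  exact: (antisym_comm q t_comm).
have /(congr1 (mulmx (p k))) := t_braid k0 kM.
rewrite !mulmxBr !mulmxA pt !mul0mx pc -[_ *m p k *m t k]mulmxA pt mulmx0 mul0mx.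
by rewrite !sub0r => /oppr_inj <-.
Qed.

Lemma antisym_eq0_mul_skip k : (0 < k)%N -> (k.+1 < M)%N ->
  (forall j, (0 < j <= k.+1)%N -> 0 < qnum q j) ->
  qnum q k.+3 + 2 * qnum q k.+1 < 0 ->
  p k.+1 = 0 -> p k *m t k.+1 = 0.
Proof.
move=> k0 kM qpos qneg pk0.
have kM1 : (0 < k < M)%N by rewrite k0 ltnW.
have qk : 0 < qnum q k by apply: qpos; rewrite k0 leqnSn.
have qk1 : 0 < qnum q k.+1 by apply: qpos; rewrite leqnn.
have [|idem _] := antisym_idem_quad q0 q1 t_quad t_braid t_comm kM1.
  by move=> j /andP[j0 jk]; rewrite gt_eqF // qpos // j0 leqW.
set A := p k in idem *; set X := t k.+1; set Y := t k.
have AYA : A *m Y *m A = (qnum q k.+1 / qnum q k) *: A.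
  have : p k.+1 = A - (qnum q k / qnum q k.+1) *: (A *m Y *m A).
    by rewrite /A /Y; case: (k) k0.
  move/eqP; rewrite pk0 eq_sym subr_eq0 => /eqP e.
  by rewrite [in RHS]e scalerA mulrA divfK ?gt_eqF // divff ?gt_eqF // scale1r.
have AX : A *m X = X *m A by apply: (antisym_comm q t_comm).
have XX : X *m X = (q + q^-1) *: X by apply: t_quad.
have aA : adjmx A = A by apply: antisym_adj; rewrite ltnW // ltnW.
have aX : adjmx X = X by apply: t_adj.
have aY : adjmx Y = Y by apply: t_adj.
(* The ratio of the Gram matrices of [A *m X *m Y *m X] and [A *m X], which are [2] A X (Y X Y) X A
   and [2] A X. *)
pose h := (qnum q k.+3 + 2 * qnum q k.+1) / qnum q k * (q + q^-1).
have h0 : h < 0 by rewrite /h pmulr_llt0 // pmulr_llt0 // invr_gt0.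
apply: (gram_neg_eq0 (y := A *m X *m Y *m X) h0).
have hE : h = ((q + q^-1) ^+ 2 * (qnum q k.+1 / qnum q k) - (q + q^-1) +
    qnum q k.+1 / qnum q k) * (q + q^-1).
  rewrite /h (qnumSS k.+1 q0) (qnumSS k q0); congr (_ * _).
  have : qnum q k != 0 by rewrite gt_eqF.
  by move: (qnum q k) (qnum q k.+1) (q + q^-1) => a b c a0; field.
have YXY : Y *m X *m Y = X *m Y *m X - X + Y.
  have := t_braid k0 kM; rewrite -/X -/Y => /eqP.
  by rewrite subr_eq => /eqP ->; rewrite addrC addrA addrAC.
have XXr m (Z : 'M[C]_(m, d)) : Z *m X *m X = (q + q^-1) *: (Z *m X).
  by rewrite -mulmxA XX scalemxAr.
have AXA : A *m X *m A = A *m X by rewrite AX -mulmxA idem.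
(* [X] commutes with [A], so both copies of [X] move outside and leave [A *m Y *m A] in the
   middle. *)
have AXYXA : A *m X *m Y *m X *m A =
    (qnum q k.+1 / qnum q k * (q + q^-1)) *: (A *m X).
  have -> : A *m X *m Y *m X *m A = X *m (A *m Y *m A) *m X.
    by rewrite -[LHS]mulmxA -AX !mulmxA -AX.
  by rewrite AYA -scalemxAr -scalemxAl -AX -mulmxA XX -scalemxAr scalerA.
have -> : A *m X *m Y *m X *m adjmx (A *m X *m Y *m X) =
    (q + q^-1) *: (A *m X *m (Y *m X *m Y) *m X *m A).
  rewrite !adjmxM aA aX aY !mulmxA -[_ *m X *m X]mulmxA XX.
  by rewrite -!scalemxAr -!scalemxAl.
have -> : A *m X *m (Y *m X *m Y) *m X *m A =
    ((q + q^-1) ^+ 2 * (qnum q k.+1 / qnum q k * (q + q^-1))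
     - (q + q^-1) ^+ 2 + qnum q k.+1 / qnum q k * (q + q^-1)) *: (A *m X).
  rewrite YXY mulmxDr mulmxBr !mulmxDl !mulNmx !mulmxA.
  rewrite !(XXr, =^~ scalemxAl) AXYXA AXA !scalerA.
  by rewrite -scalerBl -scalerDl; congr (_ *: _); ring.
rewrite adjmxM aA aX mulmxA -[A *m X *m X]mulmxA XX -scalemxAr -scalemxAl AXA.
by rewrite !scalerA hE; congr (_ *: _); ring.
Qed.

End Positivity.

(** * Kronecker products without size casts *)

(* Packing a square matrix with its size makes the Kronecker product strictly
   associative and unital, which removes the size casts. *)
Section TensorPacking.
Variable K : comPzRingType.

Definition packmx d (x : 'M[K]_d) : {d : nat & 'M[K]_d} := Tagged _ x.

Definition packtens (u v : {d : nat & 'M[K]_d}) : {d : nat & 'M[K]_d} :=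
  packmx (tagged u *t tagged v).

Lemma packmx_inj d : injective (@packmx d).
Proof. by move=> x y /eqP; rewrite eq_Tagged => /eqP. Qed.

Lemma packmx_cast d d' (h h' : d = d') (x : 'M[K]_d) :
  packmx (castmx (h, h') x) = packmx x.
Proof. by subst d'; rewrite (eq_irrelevance h' erefl) castmx_id. Qed.

Lemma packmx_conform d d' (x : 'M[K]_d) : d = d' ->
  packmx (conform_mx (0 : 'M[K]_d') x) = packmx x.
Proof. by move=> h; subst d'; rewrite conform_mx_id. Qed.

Lemma packtensE d d' (x : 'M[K]_d) (y : 'M[K]_d') :
  packmx (x *t y) = packtens (packmx x) (packmx y).
Proof. by []. Qed.

(** Indices of a Kronecker product are split by Euclidean division, so associativity comes down to
    three identities for iterated [%/] and [%%]. *)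
Lemma packtensA : associative packtens.
Proof.
move=> [m x] [n y] [p z].
have h := esym (mulnA m n p); rewrite -[RHS](packmx_cast h h).
have divnp a : (a %/ (n * p) = a %/ p %/ n)%N by rewrite mulnC divnMA.
have modnp a : (a %% (n * p) %/ p = (a %/ p) %% n)%N by rewrite modn_divl mulnC.
have modp a : ((a %% (n * p)) %% p = a %% p)%N by rewrite modn_dvdm // dvdn_mull.
congr packmx => /=; apply/matrixP => i j; rewrite castmxE !mxE /= -mulrA.
by congr (x _ _ * (y _ _ * z _ _)); apply: val_inj => /=;
  rewrite ?divnp ?modnp ?modp.
Qed.

Definition packid d := packmx (1%:M : 'M[K]_d).

Lemma packtens1l u : packtens (packid 1) u = u.
Proof.
case: u => d x; rewrite /packtens /= tens_scalar1mx; exact: packmx_cast.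
Qed.

Lemma packtens1r u : packtens u (packid 1) = u.
Proof.
case: u => d x; rewrite /packtens /= tens_mx_scalar scale1r; exact: packmx_cast.
Qed.

Lemma tensmx11 m n : (1%:M : 'M[K]_m) *t (1%:M : 'M[K]_n) = 1%:M.
Proof.
apply/matrixP => i j.
case: (mxtens_indexP i) => i0 i1; case: (mxtens_indexP j) => j0 j1.
rewrite tensmxE !mxE (can_eq (@mxtens_indexK m n)) xpair_eqE.
by rewrite -mulnb natrM.
Qed.

Lemma packtens11 m n : packtens (packid m) (packid n) = packid (m * n).
Proof. by rewrite /packtens /= tensmx11. Qed.

Lemma ntensmx_id n k : (1%:M : 'M[K]_n) ^t k = 1%:M.
Proof.
case: k => [|k]; first by rewrite ntensmx0.
by elim: k => [|k IHk]; rewrite ?ntensmx1 // ntensmxSS IHk tensmx11.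
Qed.

End TensorPacking.

Lemma tensmx_eq0 (K : idomainType) m n p r (x : 'M[K]_(m, n)) (y : 'M[K]_(p, r)) :
  x *t y = 0 -> y != 0 -> x = 0.
Proof.
move=> /matrixP xy0 y0; apply/matrixP => i j; rewrite mxE; apply/eqP.
apply: contraNT y0 => xij; apply/eqP/matrixP => k l; rewrite mxE.
have := xy0 (mxtens_index (i, k)) (mxtens_index (j, l)).
by rewrite tensmxE mxE => /eqP; rewrite mulf_eq0 (negPf xij) => /eqP.
Qed.

Lemma tensmx1_eq0 (K : idomainType) m n p (x : 'M[K]_(m, n)) : (0 < p)%N ->
  x *t (1%:M : 'M[K]_p) = 0 -> x = 0.
Proof.
case: p => // p _ /tensmx_eq0; apply; apply/eqP => /matrixP/(_ ord0 ord0)/eqP.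
by rewrite !mxE eqxx oner_eq0.
Qed.

(** * Operators on blocks of tensor factors *)

Section Sites.
Variables (K : comPzRingType) (n : nat).

(* [x], acting on [s] consecutive tensor factors of dimension [n], extended by
   [a] factors on the left and [b] on the right; meant for [a + s + b = M], and
   the zero matrix if the dimensions do not match. *)
Definition embed M a s (x : 'M[K]_(n ^ s)) b : 'M[K]_(n ^ M) :=
  conform_mx 0 ((1%:M : 'M[K]_(n ^ a)) *t x *t (1%:M : 'M[K]_(n ^ b))).
Arguments embed M a {s} x b.

Local Notation pid k := (packid K (n ^ k)).

Lemma packtens_pid a b : packtens (pid a) (pid b) = pid (a + b).
Proof. by rewrite packtens11 expnD. Qed.

Lemma embed_size a s b M : (a + s + b = M)%N -> (n ^ a * n ^ s * n ^ b = n ^ M)%N.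
Proof. by move=> <-; rewrite !expnD. Qed.

Lemma packmx_embed M a s (x : 'M[K]_(n ^ s)) b : (a + s + b = M)%N ->
  packmx (embed M a x b) = packtens (packtens (pid a) (packmx x)) (pid b).
Proof. by move=> /embed_size h; rewrite packmx_conform. Qed.

Lemma embedM M a s (x y : 'M[K]_(n ^ s)) b : (a + s + b = M)%N ->
  embed M a (x *m y) b = embed M a x b *m embed M a y b.
Proof.
(* Once [n ^ M] is generalised to a variable, the size equation can be substituted and [conform_mx]
   becomes the identity. *)
move=> /embed_size; rewrite /embed; move: (n ^ M)%N => d h; subst d.
by rewrite !conform_mx_id !tensmx_mul !mul1mx.
Qed.

Lemma embedZ M a s c (x : 'M[K]_(n ^ s)) b : (a + s + b = M)%N ->
  embed M a (c *: x) b = c *: embed M a x b.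
Proof.
move=> /embed_size; rewrite /embed; move: (n ^ M)%N => d h; subst d.
rewrite !conform_mx_id; apply/matrixP => i j; rewrite !mxE.
by rewrite mulrCA !mulrA.
Qed.

Lemma embedB M a s (x y : 'M[K]_(n ^ s)) b : (a + s + b = M)%N ->
  embed M a (x - y) b = embed M a x b - embed M a y b.
Proof.
move=> /embed_size; rewrite /embed; move: (n ^ M)%N => d h; subst d.
rewrite !conform_mx_id; apply/matrixP => i j; rewrite !mxE.
by rewrite mulrBr mulrBl.
Qed.

Lemma embed1 M a s b : (a + s + b = M)%N -> embed M a (1%:M : 'M[K]_(n ^ s)) b = 1%:M.
Proof.
move=> /embed_size; rewrite /embed; move: (n ^ M)%N => d h; subst d.
by rewrite !conform_mx_id !tensmx11.
Qed.

Lemma embed_embed M a s s' (x : 'M[K]_(n ^ s)) b a' b' :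
  (a' + s + b' = s')%N -> (a + s' + b = M)%N ->
  embed M a (embed s' a' x b') b = embed M (a + a') x (b' + b).
Proof.
move=> h h'; apply: packmx_inj.
rewrite !packmx_embed //; last by rewrite -h' -h !addnA.
by rewrite -!packtens_pid !packtensA.
Qed.

(** The packed form exhibits the product as a pure tensor, from which a nonzero factor can later be
    cancelled. *)
Lemma embed_mul_disjoint M a s (x : 'M[K]_(n ^ s)) c s' (y : 'M[K]_(n ^ s')) b :
  (a + s + c + s' + b = M)%N ->
  let xy := embed M a x (c + s' + b) *m embed M (a + s + c) y b in
  xy = embed M (a + s + c) y b *m embed M a x (c + s' + b) /\
  packmx xy = packtens (packtens (packtens (packtens (pid a) (packmx x))
    (pid c)) (packmx y)) (pid b).
Proof.
move=> hM xy.
have h : (n ^ a * n ^ s * n ^ c * n ^ s' * n ^ b = n ^ M)%N.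
  by rewrite -hM !expnD.
(* Simultaneous embedding of both blocks: it multiplies componentwise, and the two factors of [xy]
   are [F x 1%:M] and [F 1%:M y]. *)
pose F (u : 'M[K]_(n ^ s)) (v : 'M[K]_(n ^ s')) : 'M[K]_(n ^ M) :=
  conform_mx 0 ((1%:M : 'M[K]_(n ^ a)) *t u *t (1%:M : 'M[K]_(n ^ c)) *t v
                *t (1%:M : 'M[K]_(n ^ b))).
have FE u v : packmx (F u v) = packtens (packtens (packtens (packtens (pid a)
    (packmx u)) (pid c)) (packmx v)) (pid b).
  by rewrite packmx_conform.
have FM u v u' v' : F u v *m F u' v' = F (u *m u') (v *m v').
  rewrite /F; move: (n ^ M)%N h => d h; subst d.
  by rewrite !conform_mx_id !tensmx_mul !mul1mx.
have -> : xy = F x 1%:M *m F 1%:M y.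
  congr (_ *m _); apply: packmx_inj; rewrite FE packmx_embed ?addnA //.
    by rewrite -!packtens_pid !packtensA.
  by rewrite -!packtens_pid.
have -> : embed M (a + s + c) y b *m embed M a x (c + s' + b) =
    F 1%:M y *m F x 1%:M.
  congr (_ *m _); apply: packmx_inj; rewrite FE packmx_embed ?addnA //.
    by rewrite -!packtens_pid.
  by rewrite -!packtens_pid !packtensA.
by rewrite !FM !mulmx1 !mul1mx; split.
Qed.

End Sites.
Arguments embed {K n} M a {s} x b.

(** * The tensor representation built from [T] *)

Section HeckeSites.
Variables (C : numClosedFieldType) (n : nat) (q : C) (T : 'M[C]_(n ^ 2)).
Hypothesis n_gt0 : (0 < n)%N.
Hypothesis Therm : T \is hermsymmx.
Hypothesis Tquad : T *m T = (q + q^-1) *: T.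
Hypothesis Tbraid :
  tensTI T *m tensIT T *m tensTI T - tensIT T *m tensTI T *m tensIT T
  = tensTI T - tensIT T.

(* [T] acting on the tensor factors [k] and [k + 1] out of [M], counted from 1. *)
Definition site M k : 'M[C]_(n ^ M) := embed M k.-1 T (M - k.+1).

Lemma site_sumn M k : (0 < k < M)%N -> (k.-1 + 2 + (M - k.+1) = M)%N.
Proof. by case: k => // k /andP[_ kM]; rewrite /= addn2 subnKC. Qed.

Lemma embed_adj M a s (x : 'M[C]_(n ^ s)) b :
  adjmx (embed M a x b) = embed M a (adjmx x) b.
Proof.
have adjT m m' (u : 'M[C]_m) (v : 'M[C]_m') : adjmx (u *t v) = adjmx u *t adjmx v.
  by rewrite /adjmx trmx_tens map_mxT.
rewrite /embed /adjmx trmx_conform map_conform_mx trmx0 map_mx0.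
by rewrite -!/(adjmx _) !adjT /adjmx !trmx1 !map_mx1.
Qed.

Lemma site_mxE M (k : hecke_gen M) : site_mx T k = site M (val k).
Proof.
apply: packmx_inj; rewrite packmx_cast packmx_embed; last first.
  by apply: site_sumn; exact: valP k.
by rewrite !packtensE !ntensmx_id subn1 -subnDA addn1.
Qed.

Lemma site_quad M k : (0 < k < M)%N ->
  site M k *m site M k = (q + q^-1) *: site M k.
Proof. by move=> /site_sumn h; rewrite -embedM // Tquad embedZ. Qed.

Lemma site_adj M k : adjmx (site M k) = site M k.
Proof.
rewrite embed_adj; congr embed.
by have := is_hermitianmxP _ _ _ Therm; rewrite expr0 scale1r => {2}->.
Qed.

Lemma site_comm M k m : (0 < k)%N -> (k.+1 < m)%N -> (m < M)%N ->
  site M k *m site M m = site M m *m site M k.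
Proof.
case: k => // k _; case: m => // m; rewrite ltnS => km mM.
have h : (k + 2 + (m - k.+2) + 2 + (M - m.+2) = M)%N.
  by rewrite [(k + 2)%N]addn2 subnKC // addn2 subnKC.
have [+ _] := embed_mul_disjoint T T h.
have -> : (k + 2 + (m - k.+2) = m)%N by rewrite [(k + 2)%N]addn2 subnKC.
by have -> : (m - k.+2 + 2 + (M - m.+2) = M - k.+2)%N by lia.
Qed.

Lemma tensTIE : tensTI T = embed 3 0 T 1.
Proof.
apply: packmx_inj; rewrite packmx_cast packmx_embed // packtensE.
by rewrite packtens1l.
Qed.

Lemma tensITE : tensIT T = embed 3 1 T 0.
Proof.
apply: packmx_inj; rewrite packmx_cast packmx_embed // packtensE.
by rewrite packtens1r.
Qed.

(** Both sites lie in one block of three tensor factors, so [embed] carries [Tbraid] over. *)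
Lemma site_braid M k : (0 < k)%N -> (k.+1 < M)%N ->
  site M k *m site M k.+1 *m site M k - site M k.+1 *m site M k *m site M k.+1 =
  site M k - site M k.+1.
Proof.
case: k => // k _ kM; have h : (k + 3 + (M - k.+3) = M)%N by rewrite addn3 subnKC.
have -> : site M k.+1 = embed M k (tensTI T) (M - k.+3).
  by rewrite tensTIE embed_embed // /site addn0 /= add1n subnSK.
have -> : site M k.+2 = embed M k (tensIT T) (M - k.+3).
  by rewrite tensITE embed_embed // /site addn1 /= add0n.
by rewrite -!embedM // -!embedB // Tbraid.
Qed.

(** Allows factors to be added on the right and removed again: [embed] respects every operation of
    the recursion. *)
Lemma antisym_embed L M k : (0 < k <= L)%N -> (L <= M)%N ->
  embed M 0 (antisym q (site L) k) (M - L) = antisym q (site M) k.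
Proof.
move=> /andP[+ kL] LM; have h : (0 + L + (M - L) = M)%N by rewrite add0n subnKC.
elim: k kL => [|[|k] IHk] // kL _; first exact: embed1.
rewrite !antisymS embedB // embedZ // !embedM // IHk //; last exact: ltnW.
congr (_ - _ *: (_ *m _ *m _)).
rewrite embed_embed //; last by rewrite site_sumn.
by rewrite add0n /site; congr embed; rewrite addnC addnBA // subnK.
Qed.

Lemma tau_qantisym N (tau : {linear hecke N q -> 'M[C]_(n ^ N)}) k :
  monoid_morphism tau ->
  (forall k : hecke_gen N, tau (heckeT q k) = site_mx T k) ->
  (0 < k <= N)%N -> tau (qantisym N q k) = antisym q (site N) k.
Proof.
move=> [tau1 tauM] tauT /andP[].
elim: k => [|[|k] IHk] // _ kN; first by rewrite qantisym1 tau1.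
have kN' : (0 < k.+1 < N)%N by [].
have := qantisymS q (exist _ k.+1 kN' : hecke_gen N); rewrite /= => ->.
rewrite linearB linearZ /= !tauM tauT site_mxE IHk //; exact: ltnW.
Qed.

Hypothesis T0 : T != 0.

(** The antisymmetrizer lives on the first L factors and [site M L.+1] on the next two, so the
    product is a pure tensor P (x) T (x) 1, and [T] and the identity cancel. *)
Lemma antisym_mul_site_eq0 L M : (0 < L)%N -> (L.+1 < M)%N ->
  antisym q (site M) L *m site M L.+1 = 0 -> antisym q (site L) L = 0.
Proof.
move=> L0 LM; rewrite -(@antisym_embed L M L) ?L0 ?leqnn //; last by do 2!apply: ltnW.
set P := antisym q (site L) L.
have h : (0 + L + 0 + 2 + (M - L.+2) = M)%N by rewrite add0n addn0 addn2 subnKC.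
have [_] := embed_mul_disjoint P T h.
have -> : (0 + 2 + (M - L.+2) = M - L)%N.
  by rewrite add0n addnBA // addnC -[L.+2]addn2 subnDr.
rewrite add0n addn0 -/(site M L.+1) => + PT0; rewrite PT0 expn0.
rewrite -/(packid C 1) packtens1l packtens1r -!packtensE => e.
apply: (tensmx_eq0 _ T0); apply: (tensmx1_eq0 (p := n ^ (M - L.+2))).
  by rewrite expn_gt0 n_gt0.
have hd : (n ^ M = n ^ L * n ^ 2 * n ^ (M - L.+2))%N.
  by rewrite -!expnD -[in LHS]h add0n addn0.
apply: packmx_inj; rewrite -e -(packmx_cast hd hd).
by congr packmx; apply/matrixP => i j; rewrite castmxE !mxE.
Qed.

Lemma antisym_pred_eq0 N : (2 <= N)%N -> q != 0 -> q != q^-1 ->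
  (forall k : nat, (qnum q k)^* = qnum q k) ->
  (forall j, (0 < j <= N)%N -> 0 < qnum q j) ->
  qnum q N.+2 + 2 * qnum q N < 0 ->
  antisym q (site N) N.-1 = 0.
Proof.
case: N => [|[|k]] // _ q0 q1 qc qpos qneg; set N := k.+2 in qpos qneg *.
have qN : 0 < qnum q N by apply: qpos; rewrite leqnn.
have q2 : 0 < q + q^-1.
  have := qpos 2 isT; rewrite (qnumSS 0 q0) qnum1 // mulr1.
  by rewrite /qnum subrr mul0r subr0.
(* [2][N+1] = [N+2] + [N] is at most [N+2] + 2[N], which is negative. *)
have qN1 : qnum q N.+1 < 0.
  rewrite -(pmulr_rlt0 _ q2); move: qneg; rewrite (qnumSS N q0).
  set u := _ * _; move=> qneg; apply: le_lt_trans qneg.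
  rewrite -subr_ge0; suff -> : u - qnum q N + 2 * qnum q N - u = qnum q N.
    exact: ltW.
  by ring.
have quad := @site_quad N.+2; have braid := @site_braid N.+2.
have comm := @site_comm N.+2; have adj j (_ : (0 < j < N.+2)%N) := site_adj N.+2 j.
(* The two extra factors make room for [site N.+2 N.+1], which acts on factors N + 1 and N + 2. *)
have PN0 : antisym q (site N) N = 0.
  apply: (@antisym_mul_site_eq0 N N.+2) => //.
  apply: (antisym_mul_next2 braid comm) => //.
  by apply: (antisym_mul_next q0 q1 quad braid comm adj qc q2) => //=.
have pred0 : antisym q (site k.+1) k.+1 = 0.
  apply: (@antisym_mul_site_eq0 k.+1 N.+2) => //.
  apply: (antisym_eq0_mul_skip q0 q1 quad braid comm adj qc q2) => //.
  rewrite -(@antisym_embed N N.+2 N) ?leqnn //; last by rewrite ltnW.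
  rewrite PN0 -(scale0r 0) embedZ ?scale0r //.
  by rewrite add0n -[N.+2]addn2 addKn.
(* Cancellation gave the vanishing on N - 1 factors only; padding by one factor brings it to N. *)
rewrite -(@antisym_embed k.+1 N k.+1) ?leqnn // pred0.
by rewrite -(scale0r 0) embedZ ?scale0r // add0n subnKC.
Qed.

End HeckeSites.

(** * q-numbers on the unit circle *)

Section Expi.
Variable R : realType.
Implicit Type a : R.

Lemma expiD a b : expi (a + b) = expi a * expi b.
Proof.
rewrite /expi sinD cosD; apply/eqP.
by rewrite eq_complex /= [X in _ && (X == _)]addrC !eqxx.
Qed.

Lemma expi_unit a : expi a * expi (- a) = 1.
Proof. by rewrite -expiD subrr /expi cos0 sin0. Qed.

Lemma expi_neq0 a : expi a != 0.
Proof.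
apply/eqP => a0; have := expi_unit a; rewrite a0 mul0r => /eqP.
by rewrite eq_sym oner_eq0.
Qed.

Lemma expiV a : (expi a)^-1 = expi (- a).
Proof. by apply: (mulfI (expi_neq0 a)); rewrite expi_unit divff // expi_neq0. Qed.

Lemma expiX a k : expi a ^+ k = expi (k%:R * a).
Proof.
elim: k => [|k IHk]; first by rewrite expr0 mul0r /expi cos0 sin0.
by rewrite exprS IHk -expiD -natr1 mulrDl mul1r addrC.
Qed.

Lemma expi_sub_inv a : expi a - (expi a)^-1 = (sin a)%:C%C * (0 +i* 2)%C.
Proof.
rewrite expiV /expi cosN sinN; apply/eqP; rewrite eq_complex /=.
by apply/andP; split; apply/eqP; ring.
Qed.

(** The factor 2i from [expi_sub_inv] cancels in the quotient. This real form settles both the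
    conjugation invariance and the signs of the q-numbers. *)
Lemma qnum_expi a (k : nat) : qnum (expi a) k = (sin (k%:R * a) / sin a)%:C%C.
Proof.
have h : (0 +i* 2 : R[i])%C != 0 by rewrite eq_complex /= pnatr_eq0 andbF.
rewrite /qnum -exprnN -exprnP expiX !expi_sub_inv invfM mulrACA divff // mulr1.
by rewrite -fmorphV -rmorphM.
Qed.

End Expi.

Theorem proposition4 (R : realType) (N : nat) (gamma : R) (q : R[i])
  (hN : (3 <= N)%N)
  (hq : q = expi gamma)
  (hgamma1 : pi / (N + 1)%:R < gamma) (hgamma2 : gamma < pi / N%:R)
  (hbracket : qnum q (N + 2)%N%:Z + 2 * qnum q N%:Z < 0)
  (n : nat) (hn : (1 <= n)%N)
  (T : 'M[R[i]]_(n ^ 2)) (hTherm : T \is hermsymmx) (hT0 : T != 0)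
  (hTquad : T *m T = (q + q^-1) *: T)
  (hTbraid : tensTI T *m tensIT T *m tensTI T - tensIT T *m tensTI T *m tensIT T
             = tensTI T - tensIT T)
  (tau : {linear hecke N q -> 'M[R[i]]_(n ^ N)})
  (htau : monoid_morphism tau)
  (htauT : forall k : hecke_gen N, tau (heckeT q k) = site_mx T k) :
  tau (qantisym N q (N - 1)) = 0.
Proof.
have N0 : 0 < N%:R :> R by rewrite ltr0n; case: (N) hN.
have g0 : 0 < gamma.
  by apply: lt_trans hgamma1; rewrite divr_gt0 ?pi_gt0 // ltr0n addn1.
(* For these j, 0 < j gamma <= N gamma < pi. *)
have sin_gt0 j : (0 < j <= N)%N -> 0 < sin (j%:R * gamma).
  move=> /andP[j0 jN]; apply: sin_gt0_pi; rewrite mulr_gt0 ?ltr0n //=.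
  apply: (@le_lt_trans _ _ (N%:R * gamma)); first by rewrite ler_pM2r // ler_nat.
  by rewrite mulrC -ltr_pdivlMr.
have sing0 : 0 < sin gamma.
  by have := sin_gt0 1%N; rewrite mul1r; apply; case: (N) hN.
rewrite (tau_qantisym htau htauT); last first.
  by case: (N) hN => [|[|m]] //= _; rewrite subn1 /=.
rewrite subn1; apply: antisym_pred_eq0 => //.
- by case: (N) hN => [|[|m]].
- by rewrite hq expi_neq0.
- rewrite -subr_eq0 hq expi_sub_inv mulf_eq0 negb_or !eq_complex /= eqxx andbT.
  by rewrite gt_eqF //= pnatr_eq0 andbF.
- move=> k; rewrite hq qnum_expi; apply/eqP.
  by rewrite eq_complex /= oppr0 !eqxx.
- by move=> j jN; rewrite hq qnum_expi ltcR divr_gt0 // sin_gt0.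
- by rewrite addn2 in hbracket.
Qed.
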